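(* Let $n\ge 1$ and define $$\Theta = \{(x,v)\in\mathbb{R}^n\times\mathbb{R}^n \;:\; x^Tv=n,\ \|x\|_\infty\le 1,\ \|v\|_2^2\le n\}.$$ If $(x,v)\in\Theta$, then $x\in\{-1,+1\}^n$, $v\in\{-1,+1\}^n$, and $x=v$.
   Context: $\|\cdot\|_\infty$ and $\|\cdot\|_2$ denote the maximum norm and the Euclidean norm on $\mathbb{R}^n$. *)

(* Defs.v *)
From HB Require Import structures.
From mathcomp Require Import all_boot all_order all_algebra.
From mathcomp Require Import classical_sets reals normedtype.

Set Implicit Arguments.
Unset Strict Implicit.
Unset Printing Implicit Defensive.

Import Order.TTheory GRing.Theory Num.Theory.
Import numFieldNormedType.Exports.

Local Open Scope classical_set_scope.
Local Open Scope ring_scope.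

Definition norm2 (R : realType) (n : nat) (x : 'cV[R]_n) : R :=
  Num.sqrt (\sum_(i < n) x i 0 ^+ 2).

(* `|p.1| is the canonical norm of matrices, i.e. the maximum norm [mx_norm]. *)
Definition Theta (R : realType) (n : nat) : set ('cV[R]_n * 'cV[R]_n) :=
  [set p | [/\ (p.1^T *m p.2) 0 0 = n%:R,
               `|p.1| <= 1 &
               norm2 p.2 ^+ 2 <= n%:R]].
Arguments Theta : clear implicits.

Definition sign_vectors (R : realType) (n : nat) : set 'cV[R]_n :=
  [set x | forall i : 'I_n, x i 0 = -1 \/ x i 0 = 1].
Arguments sign_vectors : clear implicits.

(* Main.v *)
Require Import Defs.
From HB Require Import structures.
From mathcomp Require Import all_boot all_order all_algebra.
From mathcomp Require Import classical_sets reals normedtype.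
From mathcomp Require Import ring.

(** Expanding the square gives the identity [sum_defect],
      [\sum_i ((1 - x_i ^+ 2) + (x_i - v_i) ^+ 2)
         = n - 2 x^T v + \sum_i v_i ^+ 2],
    which is at most [n - 2 n + n = 0] on [Theta]. Since [`|x_i| <= 1], every
    summand on the left is a sum of two nonnegative terms, so all of these
    vanish: [x_i ^+ 2 = 1] and [x_i = v_i] for each [i]. *)

Set Implicit Arguments.
Unset Strict Implicit.
Unset Printing Implicit Defensive.

Import Order.TTheory GRing.Theory Num.Theory.
Import numFieldNormedType.Exports.

Local Open Scope classical_set_scope.
Local Open Scope ring_scope.

Lemma norm2_sqr (R : realType) (n : nat) (x : 'cV[R]_n) :
  norm2 x ^+ 2 = \sum_(i < n) x i 0 ^+ 2.
Proof. by rewrite sqr_sqrtr// sumr_ge0// => i _; exact: sqr_ge0. Qed.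

Lemma normr_coord_le (R : realType) (m n : nat) (A : 'M[R]_(m, n)) i j :
  `|A i j| <= `|A|.
Proof.
rewrite [leRHS]/Num.norm/= mx_normrE.
exact: (le_bigmax _ (fun k => `|A k.1 k.2|) (i, j)).
Qed.

(** When [`|x| <= 1], the left-hand side vanishes only if [x] is a sign vector equal
    to [v]; the right-hand side involves only the quantities that [Theta]
    bounds. *)
Lemma sum_defect (R : realType) (n : nat) (x v : 'cV[R]_n) :
  \sum_(i < n) ((1 - x i 0 ^+ 2) + (x i 0 - v i 0) ^+ 2) =
  n%:R - (x^T *m v) 0 0 *+ 2 + norm2 v ^+ 2.
Proof.
rewrite norm2_sqr mxE -sumrMnl -[n in n%:R]card_ord -sumr_const -sumrB.
by rewrite -big_split/=; apply: eq_bigr => i _; rewrite mxE; ring.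
Qed.

Theorem lemma1 (R : realType) (n : nat) (hn : (1 <= n)%N) (x v : 'cV[R]_n)
    (hxv : (x, v) \in Theta R n) :
  [/\ x \in sign_vectors R n, v \in sign_vectors R n & x = v].
Proof.
move: hxv; rewrite inE => -[/= xv x1 v2].
have x2_le1 i : 0 <= 1 - x i 0 ^+ 2.
  rewrite subr_ge0 -real_normK ?num_real// expr_le1//.
  exact: le_trans (normr_coord_le x i 0) x1.
have defect_ge0 i : 0 <= (1 - x i 0 ^+ 2) + (x i 0 - v i 0) ^+ 2.
  by rewrite addr_ge0 ?sqr_ge0.
have sum_eq0 : \sum_(i < n) ((1 - x i 0 ^+ 2) + (x i 0 - v i 0) ^+ 2) == 0.
  rewrite eq_le sumr_ge0// andbT sum_defect xv mulr2n opprD addrA subrr sub0r.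
  by rewrite addrC subr_le0.
have coordP i : x i 0 ^+ 2 = 1 /\ x i 0 = v i 0.
  move: sum_eq0; rewrite psumr_eq0// => /allP/(_ i (mem_index_enum i))/=.
  rewrite paddr_eq0 ?sqr_ge0// => /andP[].
  by rewrite subr_eq0 sqrf_eq0 subr_eq0 => /eqP<- /eqP.
have x_eq_v : x = v.
  by apply/colP => i; case: (coordP i).
have x_sign : x \in sign_vectors R n.
  rewrite inE => i; have [/eqP + _] := coordP i.
  by rewrite sqrf_eq1 => /orP[] /eqP; [right | left].
by split; rewrite // -x_eq_v.
Qed.
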